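(* Let $\mathcal F$ be a group frame. Then the set $A$ of frame relations constructed from $\mathcal F$ is the universe of a complete, atomic, measurable set relation algebra with base set $U=\bigcup\{G_x:x\in I\}$ and unit $E=\bigcup\{G_x\times G_y:(x,y)\in\mathcal E\}$. Its operations are union, complement relative to $E$, relational composition, converse, and the identity relation $\mathrm{id}_U$. The atoms of this algebra are the relations $R_{xy,\alpha}$, and the subidentity atoms are the relations $R_{xx,0}$. The measure of $R_{xx,0}$ is the cardinality of the group $G_x$.
   Context: A group pair consists of the following data. - Pairwise disjoint groups $G_x$ ($x\in I$), with operation $\circ$ and identity $e_x$. - An equivalence relation $\mathcal E$ on $I$. - For each $(x,y)\in\mathcal E$, an isomorphism $\varphi_{xy}:G_x/H_{xy}\to G_y/K_{xy}$, where $H_{xy}\trianglelefteq G_x$ and $K_{xy}\trianglelefteq G_y$. $X\circ Y$ denotes the complex product. For $S$ a union of cosets of $H_{xy}$, $\varphi_{xy}[S]$ is the union of the images of the cosets in $S$. A map induced by $\varphi_{xy}$ on a quotient modulo a normal subgroup $N\supseteq H_{xy}$ sends each coset $C$ of $N$ to $\varphi_{xy}[C]$. A group frame is a group pair such that for all $(x,y),(y,z)\in\mathcal E$: (i) $\varphi_{xx}$ is the identity automorphism of $G_x/\{e_x\}$; (ii) $\varphi_{yx}=\varphi_{xy}^{-1}$; (iii) $\varphi_{xy}[H_{xy}\circ H_{xz}]=K_{xy}\circ H_{yz}$; (iv) $\hat\varphi_{xy}\,;\,\hat\varphi_{yz}=\hat\varphi_{xz}$ (first $\hat\varphi_{xy}$,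 then $\hat\varphi_{yz}$). Here $\hat\varphi_{xy},\hat\varphi_{xz}$ are induced by $\varphi_{xy},\varphi_{xz}$ on $G_x/(H_{xy}\circ H_{xz})$, and $\hat\varphi_{yz}$ is induced by $\varphi_{yz}$ on $G_y/(K_{xy}\circ H_{yz})$. For each $(x,y)\in\mathcal E$ fix an enumeration without repetitions $\langle H_{xy,\gamma}:\gamma<\kappa_{xy}\rangle$ of the cosets of $H_{xy}$, with $H_{xy,0}=H_{xy}$, and put $K_{xy,\gamma}=\varphi_{xy}(H_{xy,\gamma})$. Let $R_{xy,\alpha}=\bigcup_\gamma H_{xy,\gamma}\times(K_{xy,\gamma}\circ K_{xy,\alpha})$. The set of frame relations $A$ is the set of all unions of subfamilies of the $R_{xy,\alpha}$. Relation algebra terminology: - A set relation algebra with unit an equivalence relation $E$ on $U$ is a subalgebra of the algebra of all subrelations of $E$ under union, complement relative to $E$, composition $;$, converse ${}^{-1}$ and the constant $\mathrm{id}_U$. - An element $f$ is functional if $f^{-1};f\subseteq\mathrm{id}_U$. - A subidentity atom $x$ (an atom below the identity) is measurable if its square $x;E;x$ is the sum of a set of non-zero functional elements. The number of these (here the functional atoms below the square) is its measure. - A relation algebra is measurable if its identity element is the sum of measurable atoms. *)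

(* Defs.v *)
From mathcomp Require Import all_boot all_classical.

Set Implicit Arguments.
Unset Strict Implicit.
Unset Printing Implicit Defensive.

Local Open Scope classical_set_scope.
Local Open Scope card_scope.

(* A relation on U is a set of pairs. The library's [S \; R] relates x to y  *)
(* when R (x, z) and S (z, y) for some z, i.e. R comes first although it is  *)
(* written last; [rcomp R S] restores the left-to-right order of "R ; S".    *)
Definition rcomp (U : Type) (R S : set (U * U)) : set (U * U) :=
  (S \; R)%relation.

Definition rconv (U : Type) (R : set (U * U)) : set (U * U) :=
  (R^-1)%relation.

Definition is_equivalence (U : Type) (E : set (U * U)) : Prop :=
  [/\ diagonal `<=` E, rconv E `<=` E & rcomp E E `<=` E].

(** Set relation algebras: [E] is the unit and [A] the universe. *)

Record set_relation_algebra (U : Type) (E : set (U * U))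
    (A : set (set (U * U))) : Prop := {
  sra_unit : is_equivalence E;
  sra_sub : forall R, A R -> R `<=` E;
  sra_union : forall R S, A R -> A S -> A (R `|` S);
  sra_compl : forall R, A R -> A (E `\` R);
  sra_comp : forall R S, A R -> A S -> A (rcomp R S);
  sra_conv : forall R, A R -> A (rconv R);
  sra_id : A diagonal
}.

(* The sum of a subset S of A is its supremum in the ordered set (A, `<=`);  *)
(* it is not required a priori to be the union of S.                         *)
Definition is_sum (U : Type) (A S : set (set (U * U))) (s : set (U * U)) :
    Prop :=
  [/\ A s, forall R, S R -> R `<=` s &
      forall t, A t -> (forall R, S R -> R `<=` t) -> s `<=` t].

Definition complete (U : Type) (A : set (set (U * U))) : Prop :=
  forall S, S `<=` A -> exists s, is_sum A S s.

Definition atom (U : Type) (A : set (set (U * U))) (a : set (U * U)) : Prop :=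
  [/\ A a, a <> set0 & forall R, A R -> R `<=` a -> R = set0 \/ R = a].

Definition atomic (U : Type) (A : set (set (U * U))) : Prop :=
  forall R, A R -> R <> set0 -> exists2 a, atom A a & a `<=` R.

Definition subidentity_atom (U : Type) (A : set (set (U * U)))
    (a : set (U * U)) : Prop :=
  atom A a /\ a `<=` diagonal.

Definition functional (U : Type) (f : set (U * U)) : Prop :=
  rcomp (rconv f) f `<=` diagonal.

Definition square (U : Type) (E a : set (U * U)) : set (U * U) :=
  rcomp (rcomp a E) a.

Definition measurable_atom (U : Type) (E : set (U * U))
    (A : set (set (U * U))) (a : set (U * U)) : Prop :=
  subidentity_atom A a /\
  exists2 S : set (set (U * U)),
    S `<=` [set f | [/\ A f, f <> set0 & functional f]] &
    is_sum A S (square E a).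

Definition measurable (U : Type) (E : set (U * U)) (A : set (set (U * U))) :
    Prop :=
  exists2 S : set (set (U * U)),
    S `<=` measurable_atom E A & is_sum A S diagonal.

Definition functional_atoms_below_square (U : Type) (E : set (U * U))
    (A : set (set (U * U))) (a : set (U * U)) : set (set (U * U)) :=
  [set f | [/\ atom A f, functional f & f `<=` square E a]].

(* The measure is a cardinal number, so it is specified up to equipotence.   *)
Definition has_measure (U : Type) (E : set (U * U)) (A : set (set (U * U)))
    (a : set (U * U)) (T : Type) (B : set T) : Prop :=
  measurable_atom E A a /\ functional_atoms_below_square E A a #= B.

(** Quotients of possibly infinite groups, as sets of cosets. *)

Definition cprod (G : groupType) (X Y : set G) : set G :=
  [set (a * b)%g | a in X & b in Y].

Definition normal (G : groupType) (N : set G) : Prop :=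
  group_closed (mem N) /\ forall g n, N n -> N (n ^ g)%g.

Definition cosets (G : groupType) (N : set G) : set (set G) :=
  [set C | exists g : G, C = cprod [set g] N].

(* [f] is an isomorphism from G / N to G' / N'; its values on subsets of G   *)
(* that are not cosets of N are irrelevant. The product of two cosets in a   *)
(* quotient group is their complex product.                                  *)
Definition quotient_iso (G G' : groupType) (N : set G) (N' : set G')
    (f : set G -> set G') : Prop :=
  set_bij (cosets N) (cosets N') f /\
  forall C D, cosets N C -> cosets N D -> f (cprod C D) = cprod (f C) (f D).

(* f[S] for S a union of cosets of N.                                        *)
Definition coset_image (G G' : groupType) (N : set G) (f : set G -> set G')
    (S : set G) : set G' :=
  \bigcup_(C in [set C | cosets N C /\ C `<=` S]) f C.

(* The data [Hsub x y], [Ksub x y], [phi x y] are total in (x, y) for        *)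
(* convenience; only the pairs in [idx_equiv] matter.                        *)
Record group_pair (I : Type) := GroupPair {
  grp : I -> groupType;
  idx_equiv : set (I * I);
  Hsub : forall x y : I, set (grp x);
  Ksub : forall x y : I, set (grp y);
  phi : forall x y : I, set (grp x) -> set (grp y);
  idx_equivP : is_equivalence idx_equiv;
  Hsub_normal : forall x y, idx_equiv (x, y) -> normal (@Hsub x y);
  Ksub_normal : forall x y, idx_equiv (x, y) -> normal (@Ksub x y);
  phi_iso : forall x y, idx_equiv (x, y) ->
    quotient_iso (@Hsub x y) (@Ksub x y) (@phi x y)
}.

Arguments grp {I}.
Arguments idx_equiv {I}.
Arguments Hsub {I} _ x y.
Arguments Ksub {I} _ x y.
Arguments phi {I} _ x y.

(* phi_xy[S]; on cosets of a normal N containing H_xy this is also the map   *)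
(* induced by phi_xy on the quotient modulo N.                               *)
Definition phi_image (I : Type) (F : group_pair I) (x y : I)
    (S : set (grp F x)) : set (grp F y) :=
  coset_image (Hsub F x y) (phi F x y) S.

Arguments phi_image {I} F x y S.

Record is_group_frame (I : Type) (F : group_pair I) : Prop := {
  frame_id_dom : forall x, Hsub F x x = [set 1%g];
  frame_id_cod : forall x, Ksub F x x = [set 1%g];
  frame_id : forall x C, cosets [set 1%g] C -> phi F x x C = C;
  frame_inv_dom : forall x y, idx_equiv F (x, y) -> Hsub F y x = Ksub F x y;
  frame_inv_cod : forall x y, idx_equiv F (x, y) -> Ksub F y x = Hsub F x y;
  frame_inv : forall x y, idx_equiv F (x, y) -> forall C D,
    cosets (Hsub F x y) C -> cosets (Ksub F x y) D ->
    phi F y x D = C <-> phi F x y C = D;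
  frame_image : forall x y z, idx_equiv F (x, y) -> idx_equiv F (y, z) ->
    phi_image F x y (cprod (Hsub F x y) (Hsub F x z)) =
    cprod (Ksub F x y) (Hsub F y z);
  frame_comp : forall x y z, idx_equiv F (x, y) -> idx_equiv F (y, z) ->
    forall C, cosets (cprod (Hsub F x y) (Hsub F x z)) C ->
    phi_image F y z (phi_image F x y C) = phi_image F x z C
}.

(* An enumeration without repetitions of the cosets of H_xy, for each (x, y) *)
(* in [idx_equiv]. The ordinals gamma < kappa_xy are replaced by an arbitrary*)
(* index type [kappa x y] with a distinguished element 0.                    *)
Record coset_enumeration (I : Type) (F : group_pair I) := CosetEnumeration {
  kappa : I -> I -> Type;
  kappa0 : forall x y, kappa x y;
  Hcoset : forall x y, kappa x y -> set (grp F x);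
  Hcoset_bij : forall x y, idx_equiv F (x, y) ->
    set_bij [set: kappa x y] (cosets (Hsub F x y)) (@Hcoset x y);
  Hcoset0 : forall x y, idx_equiv F (x, y) ->
    @Hcoset x y (kappa0 x y) = Hsub F x y
}.

Arguments kappa {I F}.
Arguments kappa0 {I F}.
Arguments Hcoset {I F} c x y _.

Definition Kcoset (I : Type) (F : group_pair I) (c : coset_enumeration F)
    (x y : I) (g : kappa c x y) : set (grp F y) :=
  phi F x y (Hcoset c x y g).

Arguments Kcoset {I F} c x y g.

(* The union of the groups, made pairwise disjoint by the index x.           *)
Definition base (I : Type) (F : group_pair I) : Type := {x : I & grp F x}.

Definition in_base (I : Type) (F : group_pair I) (x : I)
    (S : set (grp F x)) : set (base F) :=
  [set existT (fun i : I => grp F i : Type) x g | g in S].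

Definition frame_unit (I : Type) (F : group_pair I) : set (base F * base F) :=
  \bigcup_(p in idx_equiv F)
    (in_base [set: grp F p.1] `*` in_base [set: grp F p.2]).

Definition Rrel (I : Type) (F : group_pair I) (c : coset_enumeration F)
    (x y : I) (a : kappa c x y) : set (base F * base F) :=
  \bigcup_(g in [set: kappa c x y])
    (in_base (Hcoset c x y g) `*`
     in_base (cprod (Kcoset c x y g) (Kcoset c x y a))).

Arguments frame_unit {I} F _.
Arguments Rrel {I F} c x y a.

Definition atomic_relations (I : Type) (F : group_pair I)
    (c : coset_enumeration F) : set (set (base F * base F)) :=
  [set R | exists x y (a : kappa c x y),
     idx_equiv F (x, y) /\ R = Rrel c x y a].

Definition frame_relations (I : Type) (F : group_pair I)
    (c : coset_enumeration F) : set (set (base F * base F)) :=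
  [set R | exists2 S : set (set (base F * base F)),
     S `<=` atomic_relations c & R = \bigcup_(r in S) r].

(* Main.v *)
(* For each (x, y) the pairs (g, u) with u in phi_xy(g H_xy) form a subgroup  *)
(* P_xy of G_x * G_y, and the relations R_xy,alpha are exactly the cosets of  *)
(* P_xy. Hence the frame relations are the subsets of the unit saturated for  *)
(* "being in the same coset", which gives everything except closure under     *)
(* composition; the latter reduces to the inclusion of P_xz in the            *)
(* composition of P_xy and P_yz, which follows from (iii) and (iv). For x = y *)
(* the cosets are the right translations of G_x.                              *)

Require Import Defs.
From mathcomp Require Import all_boot all_classical.

Set Implicit Arguments.
Unset Strict Implicit.
Unset Printing Implicit Defensive.

Local Open Scope classical_set_scope.

(** An isomorphism f from G / N to G' / N' is encoded by the subgroup of all pairs (g, u) with u in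
    f(gN). This is [iso_graph], and P_xy is [phi_graph] for the indices x, y. In these terms (i)
    makes P_xx equality on G_x, (ii) makes P_yx the converse of P_xy, and (iii) with (iv) give
    [phi_graph_comp]. The classes of [cong] are the right cosets of the P_xy in the blocks of the
    unit, and by [atomic_relationsE] they are exactly the R_xy,alpha. By [frame_relationsP] the
    frame relations are the [cong]-saturated subsets of the unit. Arbitrary unions and complements
    preserve saturation, and the atoms are the classes. Converse, composition and identity are
    handled by [cong_conv], [cong_comp] and [cong_diagonal]. On the block of G_x with itself the
    classes are the graphs of the right translations. They are functional, correspond bijectively to
    the elements of G_x, and fill the square of the identity on G_x, whence measurability and the
    measure. *)

Lemma mem_coset (G : groupType) (N : set G) (g h : G) :
  cprod [set g] N h <-> N (g^-1 * h)%g.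
Proof.
split=> [[_ -> [n Nn <-]]|Nh]; first by rewrite mulKg.
by exists g => //; exists (g^-1 * h)%g => //; rewrite mulVKg.
Qed.

(** * Cosets of a normal subgroup *)

Section Normal.
Variables (G : groupType) (N : set G).
Hypothesis nN : normal N.

Lemma normal_one : N 1%g.
Proof. by case: nN => -[/set_mem]. Qed.

Lemma normal_div a b : N a -> N b -> N (a * b^-1)%g.
Proof. by case: nN => -[_ ND] _ /mem_set Na /mem_set Nb; exact/set_mem/ND. Qed.

Lemma normal_inv a : N a -> N a^-1%g.
Proof. by move=> /(normal_div normal_one); rewrite mul1g. Qed.

Lemma normal_mul a b : N a -> N b -> N (a * b)%g.
Proof. by move=> Na /normal_inv /(normal_div Na); rewrite invgK. Qed.

Lemma normal_conj a g : N a -> N (a ^ g)%g.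
Proof. by case: nN => _; apply. Qed.

Lemma coset_refl g : cprod [set g] N g.
Proof. by apply/mem_coset; rewrite mulVg; exact: normal_one. Qed.

Lemma eq_coset g h : N (g^-1 * h)%g -> cprod [set g] N = cprod [set h] N.
Proof.
move=> Ngh; apply/seteqP; split=> k /mem_coset Nk; apply/mem_coset.
  have := normal_mul (normal_inv Ngh) Nk.
  by rewrite invgM invgK -mulgA mulVKg.
by have := normal_mul Ngh Nk; rewrite -mulgA mulVKg.
Qed.

Lemma coset_one : cprod [set 1%g] N = N.
Proof. by apply/seteqP; split=> k; rewrite mem_coset invg1 mul1g. Qed.

Lemma coset_cprod g h :
  cprod (cprod [set g] N) (cprod [set h] N) = cprod [set (g * h)%g] N.
Proof.
apply/seteqP; split=> k.
  case=> a /mem_coset Na [b /mem_coset Nb <-]; apply/mem_coset.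
  have := normal_mul (normal_conj h Na) Nb.
  by rewrite conjgE invgM !mulgA mulgK.
move=> /mem_coset Nk; exists g; first exact: coset_refl.
exists (g^-1 * k)%g; last by rewrite mulVKg.
by apply/mem_coset; move: Nk; rewrite invgM mulgA.
Qed.

End Normal.

(** * The graph of an isomorphism of quotients, as a subgroup of the product *)

Section QuotientGraph.
Variables (G G' : groupType) (N : set G) (N' : set G') (f : set G -> set G').
Hypotheses (nN : normal N) (nN' : normal N') (isof : quotient_iso N N' f).

Definition iso_graph (g : G) (u : G') : Prop := f (cprod [set g] N) u.

Lemma iso_graph_coset g u : iso_graph g u ->
  f (cprod [set g] N) = cprod [set u] N'.
Proof.
case: isof => -[fC _ _] _; rewrite /iso_graph.
have [v ->] : cosets N' (f (cprod [set g] N)) by apply: fC; exists g.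
by move=> /mem_coset; exact: eq_coset.
Qed.

Lemma iso_graph_total g : exists u, iso_graph g u.
Proof.
case: isof => -[fC _ _] _.
have [v fv] : cosets N' (f (cprod [set g] N)) by apply: fC; exists g.
by exists v; rewrite /iso_graph fv; exact: coset_refl.
Qed.

Lemma iso_graph_onto u : exists g, iso_graph g u.
Proof.
case: isof => -[_ _ fS] _.
have [_ [g ->] fg] : (f @` cosets N) (cprod [set u] N') by apply: fS; exists u.
by exists g; rewrite /iso_graph fg; exact: coset_refl.
Qed.

Lemma iso_graph_mul g h u v : iso_graph g u -> iso_graph h v ->
  iso_graph (g * h)%g (u * v)%g.
Proof.
case: isof => _ fM gu hv.
rewrite /iso_graph -coset_cprod // fM; [|by exists g|by exists h].
by exists u => //; exists v.
Qed.

Lemma iso_graph_ker_cod u : iso_graph 1%g u <-> N' u.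
Proof.
have ker v : iso_graph 1%g v -> N' v.
  (* The coset f(N) contains v * v along with v; since it equals vN', the quotient v^-1 * (v * v) =
     v lies in N'. *)
  move=> /[dup] v1 /(iso_graph_mul v1); rewrite mulg1 {1}/iso_graph.
  by rewrite (iso_graph_coset v1) => /mem_coset; rewrite mulKg.
split=> [/ker//|N'u]; have [v /[dup] /ker N'v v1] := iso_graph_total 1%g.
rewrite /iso_graph (iso_graph_coset v1); apply/mem_coset.
by apply: normal_mul => //; exact: normal_inv.
Qed.

Lemma iso_graph_ker_dom g : N g -> iso_graph g 1%g.
Proof.
move=> Ng; rewrite /iso_graph (eq_coset nN (h := 1%g)).
  by apply/iso_graph_ker_cod; exact: normal_one.
by rewrite mulg1; exact: normal_inv.
Qed.

Lemma iso_graph_inv g u : iso_graph g u -> iso_graph g^-1%g u^-1%g.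
Proof.
(* Any v related to g^-1 will do: u * v is related to 1, hence lies in N', so u^-1 and v are in the
   same coset. *)
move=> gu; have [v gv] := iso_graph_total g^-1%g.
have := iso_graph_mul gu gv; rewrite mulgV => /iso_graph_ker_cod.
move=> /(normal_inv nN'); rewrite invgM => N'vu.
by rewrite /iso_graph (iso_graph_coset gv); apply/mem_coset.
Qed.

Lemma iso_graph_mulr_ker g u n : N n -> iso_graph (g * n)%g u -> iso_graph g u.
Proof.
move=> /(normal_inv nN) /iso_graph_ker_dom n1 gnu.
by have := iso_graph_mul gnu n1; rewrite mulgK mulg1.
Qed.

(** Stability under right multiplication by N makes S a union of cosets, so its image can be
    computed element by element along the graph. *)
Lemma coset_imageP S u :
  (forall g n, S g -> N n -> S (g * n)%g) ->
  coset_image N f S u <-> exists2 g, S g & iso_graph g u.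
Proof.
move=> SN; split=> [[_ [[g ->] gS] gu]|[g Sg gu]].
  by exists g => //; apply: gS; exact: coset_refl.
exists (cprod [set g] N) => //; split; first by exists g.
by move=> _ [_ -> [n Nn <-]]; exact: SN.
Qed.

End QuotientGraph.

(** * The subgroups P_xy of a group frame *)

Section Frame.
Variables (I : Type) (F : group_pair I).
Hypothesis hF : is_group_frame F.

Let E := idx_equiv F.

Lemma idx_equiv_refl x : E (x, x).
Proof. by case: (idx_equivP F) => + _ _; apply. Qed.

Lemma idx_equiv_sym x y : E (x, y) -> E (y, x).
Proof. by case: (idx_equivP F) => _ + _ Exy; apply. Qed.

Lemma idx_equiv_trans x y z : E (x, y) -> E (y, z) -> E (x, z).
Proof. by case: (idx_equivP F) => _ _ + Exy Eyz; apply; exists y. Qed.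

Definition phi_graph (x y : I) : grp F x -> grp F y -> Prop :=
  iso_graph (Hsub F x y) (phi F x y).

Section Pair.
Variables (x y : I).
Hypothesis Exy : E (x, y).

Let nH := Hsub_normal Exy.
Let nK := Ksub_normal Exy.
Let isoxy := phi_iso Exy.

Lemma phi_graph_mul g h u v :
  phi_graph g u -> phi_graph h v -> @phi_graph x y (g * h)%g (u * v)%g.
Proof. exact: iso_graph_mul isoxy _ _ _ _. Qed.

Lemma phi_graph_inv g u : phi_graph g u -> @phi_graph x y g^-1%g u^-1%g.
Proof. exact: iso_graph_inv isoxy _ _. Qed.

Lemma phi_graph_sym g u : @phi_graph x y g u -> phi_graph u g.
Proof.
move=> gu; have fg := iso_graph_coset nK isoxy gu.
rewrite /phi_graph /iso_graph (frame_inv_dom hF Exy).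
have [_ ->] := frame_inv hF Exy (ex_intro _ g erefl) (ex_intro _ u erefl).
  exact: coset_refl.
exact: fg.
Qed.

End Pair.

Lemma phi_graph_refl x (g u : grp F x) : phi_graph g u <-> g = u.
Proof.
rewrite /phi_graph /iso_graph (frame_id_dom hF) (frame_id hF); last by exists g.
rewrite mem_coset; split=> [gu|->]; last by rewrite /= mulVg.
by rewrite -[u](mulVKg g) gu mulg1.
Qed.

(* Conditions (iii) and (iv) enter here only: (iv) relates g = a * m * n to c *)
(* through some w, with m in H_xy and n in H_xz. The factor m can be dropped, *)
(* and n has by (iii) a phi_xy-image l in H_yz, by which w is corrected.      *)
Lemma phi_graph_comp x y z (a : grp F x) (c : grp F z) :
  E (x, y) -> E (y, z) -> phi_graph a c ->
  exists b : grp F y, phi_graph a b /\ phi_graph b c.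
Proof.
move=> Exy Eyz ac; have Exz := idx_equiv_trans Exy Eyz.
have [nHxy nHxz] := (Hsub_normal Exy, Hsub_normal Exz).
have [nHyz nKxy] := (Hsub_normal Eyz, Ksub_normal Exy).
have [isoxy isoyz] := (phi_iso Exy, phi_iso Eyz).
pose M := cprod (Hsub F x y) (Hsub F x z).
have MHxz g n : M g -> Hsub F x z n -> M (g * n)%g.
  move=> [m Hm [n' Hn' <-]] Hn; exists m => //; exists (n' * n)%g.
    exact: normal_mul.
  by rewrite mulgA.
(* A factor m in H_xy is moved to the left of n by n * m = (n * m * n^-1) * n, the conjugate being
   in H_xy by normality. *)
have MHxy g m : M g -> Hsub F x y m -> M (g * m)%g.
  move=> [m' Hm' [n Hn <-]] Hm; exists (m' * m ^ n^-1)%g.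
    by apply: normal_mul => //; exact: normal_conj.
  by exists n => //; rewrite conjgE invgK !mulgA mulgVK.
have M1 n : Hsub F x z n -> M n.
  move=> Hn; exists 1%g; first exact: normal_one.
  by exists n => //; rewrite mul1g.
have : phi_image F x z (cprod [set a] M) c.
  apply/(coset_imageP _ (Hsub_normal Exz)); last first.
    exists a => //; apply/mem_coset; rewrite mulVg.
    by apply: M1; exact: normal_one.
  by move=> g n /mem_coset Mg Hn; apply/mem_coset; rewrite mulgA; exact: MHxz.
rewrite -(frame_comp hF Exy Eyz); last by exists a.
case=> _ [[w ->] wS wc].
have : phi_image F x y (cprod [set a] M) w by apply: wS; exact: coset_refl.
case/(coset_imageP _ nHxy).
  by move=> g m /mem_coset Mg Hm; apply/mem_coset; rewrite mulgA; exact: MHxy.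
move=> g /mem_coset [m Hm [n Hn gE]] gw.
have [w' nw'] := iso_graph_total nKxy isoxy n.
have : phi_image F x y M w'.
  by apply/(coset_imageP _ nHxy) => //; exists n; auto.
rewrite (frame_image hF Exy Eyz) => -[k Kk [l Hl klw']].
(* Here w' = k * l with k in K_xy, so k is related to 1 and can be divided out. *)
have nl : phi_graph n l.
  have /(phi_graph_inv Exy) k1 : @phi_graph x y 1%g k.
    by apply/(iso_graph_ker_cod nHxy nKxy isoxy).
  have := phi_graph_mul Exy k1 nw'.
  by rewrite -klw' mulKg invg1 mul1g.
exists (w * l^-1)%g; split.
  apply: (iso_graph_mulr_ker nHxy nKxy isoxy Hm).
  have := phi_graph_mul Exy gw (phi_graph_inv Exy nl).
  suff -> : (g * n^-1 = a * m)%g by [].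
  by rewrite -[g](mulVKg a) -gE !mulgA mulgK.
have l1 : @phi_graph y z l 1%g.
  exact: (iso_graph_ker_dom nHyz (Ksub_normal Eyz) isoyz Hl).
have := phi_graph_mul Eyz wc (phi_graph_inv Eyz l1).
by rewrite invg1 mulg1.
Qed.

(** * The base set and the congruence of pairs *)

Definition inj x (g : grp F x) : base F := existT _ x g.

(** Cancelling the index in an equality of dependent pairs uses decidable equality of indices,
    supplied classically by [{classic I}]. *)
Lemma inj_injective x : injective (@inj x).
Proof. exact: (@existT_inj2 {classic I}). Qed.

Lemma frame_unitP (p : base F * base F) :
  frame_unit F p <-> E (projT1 p.1, projT1 p.2).
Proof.
case: p => [[x g] [y h]]; split=> [[[x' y'] Exy /= [[g' _ eg] [h' _ eh]]]|Exy].
  by move: Exy; rewrite (existT_inj1 eg) (existT_inj1 eh).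
by exists (x, y) => //; split; [exists g|exists h].
Qed.

Lemma diagonal_frame_unit : diagonal `<=` frame_unit F.
Proof.
case=> i j; rewrite /diagonal /= => <-.
by apply/frame_unitP; exact: idx_equiv_refl.
Qed.

(* Two pairs are congruent when they lie in the same R_xy,alpha. *)
Definition cong (p q : base F * base F) : Prop :=
  exists (g : grp F (projT1 p.1)) (h : grp F (projT1 p.2)),
    [/\ E (projT1 p.1, projT1 p.2), q = (inj g, inj h) &
        phi_graph (projT2 p.1 * g^-1)%g (projT2 p.2 * h^-1)%g].

Lemma cong_refl p : frame_unit F p -> cong p p.
Proof.
case: p => [[x g] [y h]] /frame_unitP /= Exy; exists g, h; split=> //=.
rewrite !mulgV; have nH := Hsub_normal Exy.
exact: (iso_graph_ker_dom nH (Ksub_normal Exy) (phi_iso Exy) (normal_one nH)).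
Qed.

Lemma cong_sym p q : cong p q -> cong q p.
Proof.
case: p => [[x g] [y h]] [g' [h' /= [Exy -> gh]]].
exists g, h; split=> //=.
by have := phi_graph_inv Exy gh; rewrite !invgF.
Qed.

Lemma cong_trans p q r : cong p q -> cong q r -> cong p r.
Proof.
case: p => [[x g] [y h]] [g' [h' /= [Exy -> gh]]] [g2 [h2 /= [_ -> gh']]].
exists g2, h2; split=> //=.
by have := phi_graph_mul Exy gh gh'; rewrite !mulgA !mulgVK.
Qed.

Lemma cong_unit p q : cong p q -> frame_unit F q.
Proof.
by case: p => [[x g] [y h]] [g' [h' /= [Exy -> _]]]; exact/frame_unitP.
Qed.

Lemma cong_conv i j q : cong (i, j) q -> cong (j, i) (q.2, q.1).
Proof.
case: i j => [x g] [y h] [g' [h' /= [Exy -> gh]]].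
by exists h', g'; split=> //=; [exact: idx_equiv_sym|exact: phi_graph_sym].
Qed.

(** Makes composites of saturated relations saturated. If b is the intermediate element given by
    [phi_graph_comp] and h is the group element of m, then m' has to solve h * m'^-1 = b, so it is
    b^-1 * h. *)
Lemma cong_comp i j m q : frame_unit F (i, m) -> frame_unit F (m, j) ->
  cong (i, j) q -> exists m', cong (i, m) (q.1, m') /\ cong (m, j) (m', q.2).
Proof.
case: i j m => [x g] [z k] [y h] /frame_unitP /= Exy /frame_unitP /= Eyz.
case=> g' [k' /= [_ -> gk]].
have [b [gb bk]] := phi_graph_comp Exy Eyz gk.
by exists (inj (b^-1 * h)%g); split;
  [exists g', (b^-1 * h)%g|exists (b^-1 * h)%g, k'];
  split=> //=; rewrite invgM invgK mulVKg.
Qed.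

Lemma cong_diagonal p q : diagonal p -> cong p q -> diagonal q.
Proof.
case: p => [[x g] [y h]] /= e; have xy : x = y by exact: existT_inj1 e.
subst y; rewrite (inj_injective e) => -[g' [h' /= [_ -> /phi_graph_refl]]].
by rewrite /diagonal /= => /mulgI /invg_inj ->.
Qed.

(** * The relations R_xy,alpha as congruence classes, frame relations as saturated sets *)

Variable c : coset_enumeration F.

(** If g represents H_xy,gamma, then K_xy,gamma times K_xy,alpha is the image of the coset of g * k,
    because phi_xy is multiplicative. *)
Lemma RrelE x y (a : kappa c x y) (k : grp F x) : E (x, y) ->
  Hcoset c x y a = cprod [set k] (Hsub F x y) ->
  Rrel c x y a = [set q | exists (g : grp F x) (h : grp F y),
    q = (inj g, inj h) /\ phi_graph (g * k)%g h].
Proof.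
move=> Exy ak; have nK := Ksub_normal Exy; have isoxy := phi_iso Exy.
have [HC _ Hs] := Hcoset_bij c Exy.
apply/seteqP; split=> q.
  case=> g _ [[a1 Ha1 e1] [b1 Hb1 e2]].
  have [g1 gE] := HC g Logic.I.
  move: Ha1 Hb1; rewrite /Kcoset ak gE => /mem_coset Ha1 [u gu [v kv b1E]].
  exists a1, b1; split; first by case: (q) e1 e2 => ? ? /= <- <-.
  rewrite -b1E; apply: phi_graph_mul => //.
  by rewrite /phi_graph /iso_graph -(eq_coset (Hsub_normal Exy) Ha1).
case=> g [h [-> gkh]].
have [g1 _ g1E] := Hs _ (ex_intro _ g erefl).
exists g1 => //; split.
  by exists g => //; rewrite g1E; exact/coset_refl/Hsub_normal.
exists h => //; rewrite /Kcoset g1E ak.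
(* To split h along the two cosets, take any u in the image of the coset of g; the remaining factor
   u^-1 * h is then related to k. *)
have [u gu] := iso_graph_total nK isoxy g.
exists u => //; exists (u^-1 * h)%g; last by rewrite mulVKg.
have := phi_graph_mul Exy (phi_graph_inv Exy gu) gkh.
by rewrite mulKg.
Qed.

Lemma Rrel_class x y (a : kappa c x y) : E (x, y) ->
  exists2 p, frame_unit F p & Rrel c x y a = [set q | cong p q].
Proof.
move=> Exy; have [HC _ _] := Hcoset_bij c Exy.
have [k ak] := HC a Logic.I.
have [v kv] := iso_graph_total (Ksub_normal Exy) (phi_iso Exy) k.
(* The class is that of (1, v), for any v in K_xy,alpha. *)
exists (@inj x 1%g, inj v); first exact/frame_unitP.
rewrite (RrelE Exy ak); apply/seteqP; split=> q.
  case=> g [h [-> gkh]]; exists g, h; split=> //=.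
  have := phi_graph_mul Exy kv (phi_graph_inv Exy gkh).
  by rewrite invgM mulVKg mul1g.
case=> g [h /= [_ -> gh]]; exists g, h; split=> //.
have := phi_graph_mul Exy (phi_graph_inv Exy gh) kv.
by rewrite mul1g invgK invgM invgK mulgVK.
Qed.

Lemma class_eq p q : cong p q -> [set r | cong p r] = [set r | cong q r].
Proof.
move=> pq; apply/seteqP; split=> r /=; last exact: cong_trans.
exact/cong_trans/cong_sym.
Qed.

Lemma atomic_relationsE :
  atomic_relations c = [set [set q | cong p q] | p in frame_unit F].
Proof.
apply/seteqP; split=> R.
  by case=> x [y [a [Exy ->]]]; have [p Up ->] := Rrel_class a Exy; exists p.
case=> -[[x g] [y h]] /frame_unitP /= Exy <-.
have [k kh] := iso_graph_onto (Ksub_normal Exy) (phi_iso Exy) h.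
have [_ _ Hs] := Hcoset_bij c Exy.
(* With k related to h, the pair (g, h) lies in R_xy,alpha as soon as H_xy,alpha contains g^-1 * k,
   since g * (g^-1 * k) = k. *)
have [a _ aE] := Hs _ (ex_intro _ (g^-1 * k)%g erefl).
exists x, y, a; split => //.
have [p Up RE] := Rrel_class a Exy.
rewrite RE; symmetry; apply: class_eq.
have : Rrel c x y a (inj g, inj h).
  by rewrite (RrelE Exy aE); exists g, h; rewrite mulVKg.
by rewrite RE.
Qed.

(** A union of classes is saturated, and conversely a saturated set is the union of the classes of
    its points. All closure properties below are checked in this form. *)
Lemma frame_relationsP R : frame_relations c R <->
  R `<=` frame_unit F /\ forall p q, R p -> cong p q -> R q.
Proof.
split=> [[S SA ->]|[RU RC]].
  split=> [p|p q] [r Sr rp]; have := SA _ Sr; rewrite atomic_relationsE.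
    by case=> p0 _ rE; move: rp; rewrite -rE => /cong_unit.
  case=> p0 _ rE pq; exists r => //; move: rp; rewrite -rE => pp0.
  exact: cong_trans pp0 pq.
exists [set [set q | cong p q] | p in R].
  by move=> _ [p Rp <-]; rewrite atomic_relationsE; exists p => //; exact: RU.
apply/seteqP; split=> [p Rp|p [_ [q Rq <-]]]; last exact: RC.
by exists [set q | cong p q]; [exists p|exact/cong_refl/RU].
Qed.

Lemma frame_relations_class p : frame_relations c [set q | cong p q].
Proof.
by apply/frame_relationsP; split=> [q /cong_unit//|q r]; exact: cong_trans.
Qed.

Lemma frame_atomE : atom (frame_relations c) = atomic_relations c.
Proof.
rewrite atomic_relationsE; apply/seteqP; split=> R.
  case=> AR /eqP/set0P [p Rp] Rmin; have [RU RC] := (frame_relationsP R).1 AR.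
  exists p; first exact: RU.
  have [] := Rmin _ (frame_relations_class p); first by move=> q; exact: RC.
    by move/seteqP => -[/(_ p (cong_refl (RU _ Rp)))].
  by [].
case=> p Up <-; split; first exact: frame_relations_class.
  by move/seteqP => -[/(_ p (cong_refl Up))].
move=> S /frame_relationsP [_ SC] Sp.
have [S0|/eqP/set0P [q Sq]] := pselect (S = set0); first by left.
right; apply/seteqP; split=> // r pr.
by apply: (SC _ _ Sq); apply: cong_trans pr; exact/cong_sym/Sp.
Qed.

(** * Closure under the operations, and arbitrary sums *)

Lemma frame_relations_algebra :
  set_relation_algebra (frame_unit F) (frame_relations c).
Proof.
split.
- split=> [|p|[i j]]; first exact: diagonal_frame_unit.
  + by move=> /frame_unitP /= pE; apply/frame_unitP; exact: idx_equiv_sym.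
  + case=> m /frame_unitP /= im /frame_unitP /= mj; apply/frame_unitP => /=.
    exact: idx_equiv_trans im mj.
- by move=> R /frame_relationsP [].
- move=> R S /frame_relationsP [RU RC] /frame_relationsP [SU SC].
  apply/frame_relationsP; split; first by rewrite subUset.
  by move=> p q [Rp|Sp] pq; [left; exact: RC pq|right; exact: SC pq].
- move=> R /frame_relationsP [RU RC]; apply/frame_relationsP; split=> [p []//|].
  move=> p q [Up NRp] pq; split; first exact: cong_unit pq.
  by move=> Rq; apply: NRp; exact/(RC _ _ Rq)/cong_sym.
- move=> R S /frame_relationsP [RU RC] /frame_relationsP [SU SC].
  apply/frame_relationsP; split=> [[i j]|[i j] q] [m /= im mj].
    have /frame_unitP /= Eim := RU _ im; have /frame_unitP /= Emj := SU _ mj.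
    by apply/frame_unitP; exact: idx_equiv_trans Eim Emj.
  case/(cong_comp (RU _ im) (SU _ mj)) => m' [imq mjq].
  by exists m'; [exact: RC imq|exact: SC mjq].
- move=> R /frame_relationsP [RU RC]; apply/frame_relationsP.
  split=> [p|[i j] q].
    by move=> /RU /frame_unitP /= ?; apply/frame_unitP; exact: idx_equiv_sym.
  by move=> Rp /cong_conv; exact: RC.
- apply/frame_relationsP.
  by split; [exact: diagonal_frame_unit|exact: cong_diagonal].
Qed.

Lemma frame_relations_bigcup S : S `<=` frame_relations c ->
  frame_relations c (\bigcup_(r in S) r).
Proof.
move=> SA; apply/frame_relationsP; split=> [p|p q] [r Sr rp];
  have /frame_relationsP [rU rC] := SA _ Sr; first exact: rU.
by move=> pq; exists r => //; exact: rC pq.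
Qed.

(** The union of a family of frame relations is again a frame relation, so the supremum taken inside
    the algebra is the union itself. *)
Lemma is_sum_bigcup S s : S `<=` frame_relations c -> s = \bigcup_(r in S) r ->
  is_sum (frame_relations c) S s.
Proof.
move=> SA ->; split; first exact: frame_relations_bigcup.
  by move=> r Sr p rp; exists r.
by move=> t _ St; exact: bigcup_sub.
Qed.

(** * Translations of G_x: subidentity atoms and measure *)

Definition translation x (k : grp F x) : set (base F * base F) :=
  [set p | exists g, p = (inj g, inj (g * k)%g)].

Lemma translation_class x (k : grp F x) :
  translation k = [set q | cong (@inj x 1%g, inj k) q].
Proof.
apply/seteqP; split=> q.
  case=> g ->; exists g, (g * k)%g; split=> //=; first exact: idx_equiv_refl.
  by apply/phi_graph_refl; rewrite mul1g invgM mulVKg.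
case=> g [h /= [_ -> /phi_graph_refl gh]]; exists g; congr (_, inj _).
by rewrite -[g]invgK -[g^-1%g]mul1g gh invgM invgK mulgVK.
Qed.

Lemma translation_functional x (k : grp F x) : functional (translation k).
Proof.
case=> i j [m /= [g [-> ->]] [g' [/inj_injective -> ->]]].
by [].
Qed.

Lemma translation_inj x : injective (@translation x).
Proof.
move=> k k' kk'.
have [g []] : translation k' (@inj x 1%g, inj (1 * k)%g).
  by rewrite -kk'; exists 1%g.
by move=> /inj_injective <- /inj_injective; rewrite !mul1g.
Qed.

Lemma translation_atom x (k : grp F x) :
  atom (frame_relations c) (translation k).
Proof.
rewrite frame_atomE atomic_relationsE translation_class; eexists; last by [].
exact/frame_unitP/idx_equiv_refl.
Qed.

(** An atom is a class, hence determined by any one of its pairs, and the translation carrying g to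
    h is the class through that pair. *)
Lemma atom_translation x (g h : grp F x) R : atom (frame_relations c) R ->
  R (inj g, inj h) -> R = translation (g^-1 * h)%g.
Proof.
rewrite frame_atomE atomic_relationsE => -[p _ <-] /class_eq ->.
rewrite translation_class; symmetry; apply: class_eq.
have : translation (g^-1 * h)%g (inj g, inj h) by exists g; rewrite mulVKg.
by rewrite translation_class.
Qed.

Lemma Rrel_id x : Rrel c x x (kappa0 c x x) = translation (1%g : grp F x).
Proof.
have Exx := idx_equiv_refl x.
rewrite (@RrelE _ _ _ 1%g Exx); last first.
  by rewrite (Hcoset0 c Exx) coset_one.
apply/seteqP; split=> q.
  by case=> g [h [-> /phi_graph_refl <-]]; exists g.
by case=> g ->; exists g, (g * 1)%g; split=> //; exact/phi_graph_refl.
Qed.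

Lemma square_translation x :
  square (frame_unit F) (translation (1%g : grp F x)) =
  \bigcup_(k in [set: grp F x]) translation k.
Proof.
apply/seteqP; split=> [[i j]|[i j]].
  case=> m [m' /= [g [-> _]] _] [h [_ ->]]; exists (g^-1 * h)%g => //.
  by exists g; rewrite mulVKg mulg1.
case=> k _ [g [-> ->]]; exists (inj (g * k)%g).
  exists (inj g); first by exists g; rewrite mulg1.
  exact/frame_unitP/idx_equiv_refl.
by exists (g * k)%g; rewrite mulg1.
Qed.

(** An atom below the diagonal contains some pair (g, g), so it is the translation by g^-1 * g =
    1. *)
Lemma subidentity_atomP R : subidentity_atom (frame_relations c) R <->
  exists x, R = translation (1%g : grp F x).
Proof.
split=> [[aR Rd]|[x ->]].
  have [_ /eqP/set0P [[i j] Rij] _] := aR.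
  have ij : i = j by exact: Rd Rij.
  subst j.
  case: i Rij => x g Rg; exists x.
  by rewrite (atom_translation aR Rg) mulVg.
by split; [exact: translation_atom|move=> _ [g ->]; rewrite mulg1].
Qed.

Lemma measurable_translation x :
  measurable_atom (frame_unit F) (frame_relations c)
    (translation (1%g : grp F x)).
Proof.
split; first by apply/subidentity_atomP; exists x.
exists (range (@translation x)).
  move=> _ [k _ <-]; have [? ? _] := translation_atom k.
  by split=> //; exact: translation_functional.
apply: is_sum_bigcup; last by rewrite bigcup_image square_translation.
by move=> _ [k _ <-]; have [] := translation_atom k.
Qed.

Lemma functional_atomsE x :
  functional_atoms_below_square (frame_unit F) (frame_relations c)
    (translation (1%g : grp F x)) = range (@translation x).
Proof.
rewrite /functional_atoms_below_square square_translation.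
apply/seteqP; split=> R.
  case=> aR _ Rsq; have [_ /eqP/set0P [p Rp] _] := aR.
  have [k _ [g pE]] := Rsq _ Rp; rewrite pE in Rp.
  by exists k => //; rewrite (atom_translation aR Rp) mulKg.
case=> k _ <-; split; [exact: translation_atom|exact: translation_functional|].
exact: bigcup_sup.
Qed.

End Frame.

Theorem theorem4p2 (I : Type) (F : group_pair I) (hF : is_group_frame F)
    (c : coset_enumeration F) :
  [/\ set_relation_algebra (frame_unit F) (frame_relations c),
      complete (frame_relations c),
      atomic (frame_relations c) &
      measurable (frame_unit F) (frame_relations c)] /\
  [/\ forall R : set (base F * base F), atom (frame_relations c) R <->
        exists (x y : I) (a : kappa c x y), idx_equiv F (x, y) /\ R = Rrel c x y a,
      forall R : set (base F * base F),
        subidentity_atom (frame_relations c) R <->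
        exists x : I, R = Rrel c x x (kappa0 c x x) &
      forall x : I,
        has_measure (frame_unit F) (frame_relations c) (Rrel c x x (kappa0 c x x))
          [set: grp F x]].
Proof.
split; split.
- exact: frame_relations_algebra.
- by move=> S SA; exists (\bigcup_(r in S) r); exact: is_sum_bigcup.
(* A non-empty union of relations R_xy,alpha includes one of them, which is an atom. *)
- move=> _ [S SA ->] /eqP/set0P [p [r Sr _]].
  by exists r; [rewrite frame_atomE //; exact: SA|move=> q rq; exists r].
- exists (range (fun x => translation (1%g : grp F x))).
    by move=> _ [x _ <-]; exact: measurable_translation.
  apply: is_sum_bigcup => //.
    by move=> _ [x _ <-]; have [] := translation_atom hF c (1%g : grp F x).
  rewrite bigcup_image; apply/seteqP; split=> [[[x g] j]|_ [x _ [g ->]]].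
    by rewrite /diagonal /= => <-; exists x => //; exists g; rewrite mulg1.
  by rewrite mulg1.
- by move=> R; rewrite frame_atomE.
- move=> R; rewrite subidentity_atomP //.
  by split=> -[x ->]; exists x; rewrite Rrel_id.
- move=> x; rewrite Rrel_id // /has_measure functional_atomsE //.
  split; first exact: measurable_translation.
  (* The functional atoms below the square form the range of [translation], and injectivity makes
     that range equipotent to G_x. *)
  by apply: inj_card_eq => k k' _ _; exact: translation_inj.
Qed.
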